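(* Let $\alpha=(\alpha_n)_{n=1}^\infty$ be any sequence of positive real numbers. Then: (a) $A_\alpha$ is a strong Ditkin algebra if and only if $\liminf_{n\to\infty}\alpha_n<\infty$, i.e. $(\alpha_n)$ does not diverge to $\infty$. (b) In $A_\alpha$, the ideal $M_\infty=\{f\in A_\alpha:f(\infty)=0\}$ has a bounded approximate identity if and only if $\liminf_{n\to\infty}\alpha_n<\infty$. (c) The Banach function algebra $A_\alpha$ has bounded relative units in the sense of Bade if and only if $\liminf_{n\to\infty}\alpha_n<\infty$. (d) The algebra $A_\alpha$ has bounded relative units in the sense of Dales if and only if the sequence $(\alpha_n)$ is bounded.
   Context: $\mathbb{N}=\{1,2,3,\dots\}$, and $\mathbb{N}_\infty=\mathbb{N}\cup\{\infty\}$ is the one point compactification of $\mathbb{N}$. $C(\mathbb{N}_\infty)$ is the algebra of continuous complex-valued functions on $\mathbb{N}_\infty$, with uniform norm $\|f\|_\infty=\sup\{|f(n)|:n\in\mathbb{N}\}$. For a sequence $\alpha=(\alpha_n)_{n=1}^\infty$ of positive real numbers, $$A_\alpha=\left\{f\in C(\mathbb{N}_\infty):\sum_{n=1}^\infty \alpha_n|f(n+1)-f(n)|<\infty\right\},$$ with norm $\|f\|=\|f\|_\infty+\sum_{n=1}^\infty\alpha_n|f(n+1)-f(n)|$. A Banach function algebra on a compact Hausdorff space $X$ is a subalgebra of $C(X)$ containing the constants and separating the points of $X$, with a complete algebra norm. $A_\alpha$ is a Banach function algebra on $\mathbb{N}_\infty$, and its character space is $\mathbb{N}_\infty$ (every character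 is evaluation at a point of $\mathbb{N}_\infty$). Let $A$ be a unital Banach function algebra, regarded as an algebra of functions on its character space $\Phi_A$. For $\phi\in\Phi_A$, $M_\phi=\{f\in A: f(\phi)=0\}$ and $J_\phi=\{f\in A: f \text{ vanishes on some neighbourhood of } \phi\}$. $A$ is strongly regular if $J_\phi$ is dense in $M_\phi$ for every $\phi\in\Phi_A$. $A$ is a strong Ditkin algebra if it is strongly regular and every maximal ideal of $A$ has a bounded approximate identity. $A$ has bounded relative units at $\phi$ (with bound $C\ge 1$) if for all compact sets $E\subseteq\Phi_A\setminus\{\phi\}$ there is $f\in J_\phi$ with $\|f\|\le C$ and $f(E)\subseteq\{1\}$. $A$ has bounded relative units in the sense of Bade if for every $\phi\in\Phi_A$ there is some $C\ge1$ (possibly depending on $\phi$) such that $A$ has bounded relative units at $\phi$ with bound $C$. $A$ has bounded relative units in the sense of Dales if there is a single constant $C\ge 1$, independent of $\phi$, such that $A$ has bounded relative units at every $\phi\in\Phi_A$ with bound $C$. *)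

(* Defs.v *)
From HB Require Import structures.
From mathcomp Require Import all_boot all_order all_algebra complex.
From mathcomp Require Import all_classical all_reals all_analysis.

Set Implicit Arguments.
Unset Strict Implicit.
Unset Printing Implicit Defensive.

Import Order.TTheory GRing.Theory Num.Theory.
Import ComplexField.Normc.
Import numFieldNormedType.Exports.
Local Open Scope classical_set_scope.
Local Open Scope complex_scope.
Local Open Scope ring_scope.

(* A unital Banach function algebra enters the following definitions as a
   commutative unital complex algebra [A] with a norm [nrm : A -> R]; an
   element [f] is seen as a function on the character space through
   [phi |-> phi f].  Topologically [R[i]^o] is the complex plane. *)
Section BanachFunctionAlgebra.
Variables (R : realType) (A : comAlgType R[i]) (nrm : A -> R).
Implicit Types (f g : A) (phi psi : {ptws A -> R[i]^o}).

(* Morphisms of [A] preserve 1, so these are the nonzero multiplicative linear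
   functionals.  The Gelfand topology is the one induced by pointwise
   convergence on [A]. *)
Definition character_space : set {ptws A -> R[i]^o} :=
  range (fun chi : {lrmorphism A -> R[i]^o} => chi : {ptws A -> R[i]^o}).

Definition ideal_at phi : set A := [set f | phi f = 0].

Definition ideal_near phi : set A :=
  [set f | \forall psi \near within character_space (nbhs phi), psi f = 0].

Definition norm_dense (J M : set A) : Prop :=
  forall f, M f -> forall e : R, 0 < e -> exists2 g, J g & nrm (f - g) < e.

Definition strongly_regular : Prop :=
  forall phi, character_space phi -> norm_dense (ideal_near phi) (ideal_at phi).

(* Ideals in the sense of [idealr_closed] are proper. *)
Definition maximal_ideal (M : {pred A}) : Prop :=
  idealr_closed M /\
  forall I : {pred A}, idealr_closed I -> {subset M <= I} -> {subset I <= M}.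

(* A net is given as a family [e] indexed by a type [T] with a proper filter
   [F]; the filter of tails of a directed set is the usual case. *)
Definition has_bounded_approximate_identity (M : set A) : Prop :=
  exists (T : Type) (F : set_system T) (e : T -> A) (C : R),
    [/\ ProperFilter F,
        forall t, M (e t) /\ nrm (e t) <= C &
        forall f, M f -> nrm (e t * f - f) @[t --> F] --> (0 : R)].

Definition strong_ditkin : Prop :=
  strongly_regular /\
  forall M : {pred A}, maximal_ideal M ->
    has_bounded_approximate_identity [set f | f \in M].

Definition bounded_relative_units_at phi (C : R) : Prop :=
  forall E : set {ptws A -> R[i]^o},
    compact E -> E `<=` character_space `\ phi ->
    exists f, [/\ ideal_near phi f, nrm f <= C & forall psi, E psi -> psi f = 1].

Definition bounded_relative_units_Bade : Prop :=
  forall phi, character_space phi ->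
    exists2 C : R, 1 <= C & bounded_relative_units_at phi C.

Definition bounded_relative_units_Dales : Prop :=
  exists2 C : R, 1 <= C &
    forall phi, character_space phi -> bounded_relative_units_at phi C.

End BanachFunctionAlgebra.

(* The point [Some n] of [Ninfty] stands for the positive integer n + 1, and
   [None] for infinity; likewise [alpha n] below stands for the weight of index
   n + 1. *)
Notation Ninfty := (one_point_compactification nat).

Section Aalpha.
Variables (R : realType) (alpha : nat -> {posnum R}).
Implicit Types f g : Ninfty -> R[i]^o.

Definition variation f : \bar R :=
  (\sum_(0 <= n <oo)
    ((alpha n)%:num * normc (f (Some n.+1) - f (Some n)))%:E)%E.

Definition Aalpha_pred : {pred Ninfty -> R[i]^o} :=
  [pred f | `[< continuous f /\ (variation f < +oo)%E >]].

Record Aalpha := MkAalpha {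
  Aalpha_val :> Ninfty -> R[i]^o ;
  _ : Aalpha_val \in Aalpha_pred }.

HB.instance Definition _ := [isSub for Aalpha_val].
HB.instance Definition _ := [Choice of Aalpha by <:].

Definition uniform_norm f : R := sup (range (fun n : nat => normc (f (Some n)))).

Definition Aalpha_norm (f : Aalpha) : R := uniform_norm f + fine (variation f).

Let normcE (z : R[i]) : `|z| = (normc z)%:C. Proof. by []. Qed.

Let normc_ge0 (z : R[i]) : 0 <= normc z.
Proof. by case: z => a b; exact: sqrtr_ge0. Qed.

Let term_ge0 f n :
  (0%E <= ((alpha n)%:num * normc (f (Some n.+1) - f (Some n)))%:E)%E.
Proof. by rewrite lee_fin mulr_ge0. Qed.

Let bounded_Ninfty f :
  continuous f -> exists B : R, forall x, normc (f x) <= B.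
Proof.
move=> cf; pose h x : R := normc (f x).
have ch : continuous h.
  move=> x; apply/(@cvgrPdist_lt R R _ _ (nbhs_filter x)) => e e0.
  have /(@cvgrPdist_lt _ R[i]^o _ _ (nbhs_filter x))/(_ e%:C) := cf x.
  rewrite ltcR => /(_ e0); apply: filterS => t.
  rewrite [X in X < _ -> _]normcE ltcR; apply: le_lt_trans.
  exact: (@ler_dist_dist _ (Rcomplex R)).
have /compact_bounded [M [Mr MB]] : compact (h @` [set: Ninfty]).
  apply: continuous_compact; first exact: continuous_subspaceT.
  exact: one_point_compactification_compact.
exists (M + 1) => x; have /= := MB (M + 1) _ (h x) (imageT h x).
by rewrite ltrDl ltr01 => /(_ isT); exact: le_trans (ler_norm _).
Qed.

Lemma variation_lincomb (a b : R) f g h :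
  0 <= a -> 0 <= b ->
  (forall n, normc (h (Some n.+1) - h (Some n)) <=
     a * normc (f (Some n.+1) - f (Some n)) +
     b * normc (g (Some n.+1) - g (Some n))) ->
  (variation f < +oo)%E -> (variation g < +oo)%E -> (variation h < +oo)%E.
Proof.
move=> a0 b0 H vf vg.
apply: (@le_lt_trans _ _ (a%:E * variation f + b%:E * variation g)%E); last first.
  rewrite lte_add_pinfty// lte_mul_pinfty//.
rewrite /variation -!nneseriesZl//; try by move=> n _; exact: term_ge0.
rewrite -nneseriesD//; try by move=> n _ _; rewrite mule_ge0// lee_fin.
apply: lee_nneseries => [n _ _|n _]; first exact: term_ge0.
rewrite -!EFinM -EFinD lee_fin.
apply: (le_trans (ler_wpM2l _ (H n))) => //.
by rewrite mulrDr !(mulrCA (alpha n)%:num).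
Qed.

Lemma Aalpha_subring : subring_closed Aalpha_pred.
Proof.
split.
- apply/asboolP; split; first exact: (@cst_continuous _ R[i]^o).
  rewrite /variation eseries0// => n _ _.
  by rewrite [X in normc X](subrr (1 : R[i])) [normc _]normc0 mulr0.
- move=> f g /asboolP[cf vf] /asboolP[cg vg]; apply/asboolP; split.
    by move=> x; exact: (@continuousB _ R[i]^o _ _ _ x (cf x) (cg x)).
  apply: (@variation_lincomb 1 1 f g) => // n.
  rewrite !mul1r -[normc (g _ - _)]normcN; apply: le_trans (le_normcD _ _).
  suff -> : (f - g) (Some n.+1) - (f - g) (Some n) =
      f (Some n.+1) - f (Some n) - (g (Some n.+1) - g (Some n)) :> R[i] by [].
  by rewrite /= !opprD addrACA.
- move=> f g /asboolP[cf vf] /asboolP[cg vg]; apply/asboolP; split.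
    by move=> x; exact: (@continuousM _ _ _ _ x (cf x) (cg x)).
  have [B fB] := bounded_Ninfty cf; have [D gD] := bounded_Ninfty cg.
  apply: (@variation_lincomb D B f g) => // [||n].
  + exact: le_trans (gD None).
  + exact: le_trans (fB None).
  have -> : (f * g) (Some n.+1) - (f * g) (Some n) =
     g (Some n) * (f (Some n.+1) - f (Some n)) +
     f (Some n.+1) * (g (Some n.+1) - g (Some n)) :> R[i].
    rewrite !mulrBr [RHS]addrC addrA -[LHS]/(f _ * g _ - f _ * g _).
    by rewrite [g _ * f _]mulrC subrK [g _ * f _]mulrC.
  apply: le_trans (le_normcD _ _) _; rewrite !normcM.
  by apply: lerD; rewrite ler_wpM2r.
Qed.

HB.instance Definition _ :=
  GRing.isSubringClosed.Build _ Aalpha_pred Aalpha_subring.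

Lemma Aalpha_scaler : GRing.scaler_closed Aalpha_pred.
Proof.
move=> a f /asboolP[cf vf]; apply/asboolP; split.
  by move=> x; exact: (@continuousM _ _ (cst (a : R[i]^o)) _ x (@cst_continuous _ _ _ x) (cf x)).
apply: (@variation_lincomb (normc a) 0 f f) => // n.
by rewrite mul0r addr0 -normcM mulrBr.
Qed.

HB.instance Definition _ :=
  GRing.isScaleClosed.Build _ _ Aalpha_pred Aalpha_scaler.

HB.instance Definition _ := [SubChoice_isSubComNzRing of Aalpha by <:].
HB.instance Definition _ := [SubZmodule_isSubLmodule of Aalpha by <:].

Let Aalpha_scalerAl (a : R[i]) (f g : Aalpha) : a *: (f * g) = (a *: f) * g.
Proof. by apply/val_inj/funext => x; rewrite /= [LHS]scalerAl. Qed.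

HB.instance Definition _ :=
  GRing.Lmodule_isLalgebra.Build R[i] Aalpha Aalpha_scalerAl.
HB.instance Definition _ := GRing.Lalgebra_isComAlgebra.Build R[i] Aalpha.

End Aalpha.

(* Main.v *)
Require Import Defs.
From HB Require Import structures.
From mathcomp Require Import all_boot all_order all_algebra complex.
From mathcomp Require Import all_classical all_reals all_analysis.
From mathcomp Require Import ring.
Import Order.TTheory GRing.Theory Num.Theory.
Import numFieldNormedType.Exports.
Local Open Scope classical_set_scope.
Local Open Scope ring_scope.
Import ComplexField.Normc.

(** The whole theorem is governed by the idempotents [initial N], the indicator
functions of the first [N] integers.  Writing [a_N] for the weight of the jump
between the integers of index [N] and [N + 1], [initial N.+1] has norm at most
[1 + a_N], since it is bounded by 1 and jumps only once; and a function [f] must move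
from its value at [N] to its value at infinity, so if all weights of index at
least [N] are at least [K] then the norm of [f] is at least [K * |f(N) - f(oo)|]
([tail_weight_le_norm]).

The weights do not diverge to infinity exactly when infinitely many of them
lie below a common bound ([limn_einf_ltyP]).  Along such indices the functions [initial N.+1] are bounded, they vanish near infinity, they are 1 on
any given compact set avoiding infinity once [N] is large, and
[initial N.+1 * f] tends to [f] for each [f] in the maximal ideal at infinity:
the error is controlled by the supremum of [f] beyond [N] and by the tail of the
series of its variation ([initial_mul_cvg]).  This gives the approximate
identity at infinity, strong regularity there and the relative units there.
Conversely, bounded relative units at infinity, or a bounded approximate
identity of the ideal at infinity, produce elements of bounded norm that vanish
at infinity and stay away from 0 at an arbitrarily prescribed [N]; the lower
bound of the norm then forbids divergence ([liminf_finite_of_drop]).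

At an integer [n] nothing happens asymptotically: the complement of the
indicator of [n] is an identity of the maximal ideal and vanishes near [n].  Its
norm is bounded in terms of the two weights adjacent to [n], and the norm of any
relative unit which is 0 at [n] and 1 at [n + 1] is at least [a_n]; hence a
uniform bound exists exactly when the weights are bounded.

That nothing else has to be considered is the determination of the characters
and of the maximal ideals.  Both follow from one fact: a proper ideal is
contained in the ideal of functions vanishing at some point
([proper_ideal_at_point]).  If the ideal misses the indicator of some [n], then
all its members vanish at [n].  Otherwise it contains every [initial N], and if a
member [f] did not vanish at infinity, replacing its first values by 1 would give
a member that is bounded away from 0, hence invertible. *)

(** * The one-point compactification of the integers *)

Section Ninfty_topology.
Set Implicit Arguments.
Unset Strict Implicit.

(** On an infinite set, the cofinite filter is proper but has no cluster point,
because points are open. *)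
Lemma compact_nat_bounded (W : set nat) :
  compact W -> \forall n \near \oo, ~ W n.
Proof.
move=> cW; apply: contrapT => nW.
have WF : ProperFilter (within W \oo).
  apply: Build_ProperFilter_ex => P WP; apply: contrapT => nP; apply: nW.
  by apply: (@filterS _ \oo _ _ _ _ WP) => n WPn Wn; apply: nP; exists n; exact: WPn.
have WW : within W \oo W by exact: withinT.
have [p [_ clp]] := cW _ WF WW.
have pF : within W \oo [set n | (p < n)%N].
  by apply: (@cvg_within _ \oo); exact: nbhs_infty_gt.
by have [n [/= pn np]] := clp _ _ pF (discrete_set1 p); rewrite np ltnn in pn.
Qed.

Lemma near_infinity (P : set Ninfty) :
  nbhs (None : Ninfty) P <-> P None /\ \forall n \near \oo, P (Some n).
Proof.
split=> [[W [cW _] WP]|[P0 [N _ NP]]].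
  split; first by apply: WP; right.
  have := compact_nat_bounded cW.
  by apply: filterS => n nWn; apply: WP; left; exists n.
exists `I_N; first split.
- by apply: finite_compact; exact: finite_II.
- exact: discrete_closed.
- by case=> [n|] [[m /= Nm] [<-]|//] //; apply: NP; rewrite /= leqNgt; exact/negP.
Qed.

Lemma near_isolated (n : nat) (P : set Ninfty) : P (Some n) -> nbhs (Some n : Ninfty) P.
Proof.
by move=> Pn; rewrite /nbhs /= nbhs_principalE => m ->.
Qed.

Lemma Ninfty_continuousP (T : topologicalType) (f : Ninfty -> T) :
  continuous f <-> f (Some n) @[n --> \oo] --> f None.
Proof.
split=> [cf A /cf /near_infinity[]//|cf [n|] A fA].
  by apply: near_isolated; exact: nbhs_singleton.
by apply/near_infinity; split; [exact: nbhs_singleton | exact: cf].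
Qed.

End Ninfty_topology.

(** * The norm *)

Section Aalpha_algebra.
Set Implicit Arguments.
Unset Strict Implicit.
Variables (R : realType) (alpha : nat -> {posnum R}).
Local Notation A := (Aalpha alpha).
Local Notation var := (Defs.variation alpha).
Implicit Types (f g : A) (h : Ninfty -> R[i]^o).

Let jump h n : \bar R := ((alpha n)%:num * normc (h (Some n.+1) - h (Some n)))%:E.

Let normc_ge0 (z : R[i]) : 0 <= normc z.
Proof. by case: z => a b; exact: sqrtr_ge0. Qed.

Let jump_ge0 h n : (0 <= jump h n)%E.
Proof. by rewrite lee_fin mulr_ge0. Qed.

Lemma Aalpha_continuous f : continuous f.
Proof. by case: f => h /= /asboolP[]. Qed.

Lemma variation_lty f : (var f < +oo)%E.
Proof. by case: f => h /= /asboolP[]. Qed.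

Lemma variation_ge0 h : (0 <= var h)%E.
Proof. by apply: nneseries_ge0 => n _ _; exact: jump_ge0. Qed.

Lemma fine_variation f : (fine (var f))%:E = var f.
Proof. by rewrite fineK// ge0_fin_numE ?variation_lty// variation_ge0. Qed.

Lemma Aalpha_cvg f (e : R) : 0 < e ->
  \forall n \near \oo, normc (f (Some n) - f None) < e.
Proof.
move=> e0; have /Ninfty_continuousP := @Aalpha_continuous f.
move=> /(@cvgrPdist_lt _ R[i]^o _ _ _)/(_ e%:C%C).
by rewrite ltcR => /(_ e0); apply: filterS => n /=; rewrite distrC ltcR.
Qed.

Lemma Aalpha_bounded f : exists B : R, forall n, normc (f (Some n)) <= B.
Proof.
have [N _ NP] := Aalpha_cvg f (@ltr01 R).
exists (normc (f None) + 1 + \sum_(i < N) normc (f (Some (i : nat)))) => n.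
have [nN|Nn] := ltnP n N.
  rewrite (bigD1 (Ordinal nN))//= addrCA lerDl !addr_ge0//.
  exact: sumr_ge0.
rewrite -[f (Some n)](subrK (f None)).
apply: (le_trans (le_normcD _ _)); rewrite addrC -addrA lerD2l.
by rewrite (le_trans (ltW (NP _ Nn)))// lerDl sumr_ge0.
Qed.

Lemma uniform_norm_ub f n : normc (f (Some n)) <= uniform_norm f.
Proof.
have [B fB] := Aalpha_bounded f.
by apply: ub_le_sup; [exists B => _ [m _ <-]|exists n].
Qed.

Lemma normc_le_norm f n : normc (f (Some n)) <= Aalpha_norm f.
Proof.
by rewrite (le_trans (uniform_norm_ub f n))// lerDl fine_ge0 ?variation_ge0.
Qed.

Lemma uniform_norm_le h (B : R) :
  (forall n, normc (h (Some n)) <= B) -> uniform_norm h <= B.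
Proof.
move=> hB; apply: ge_sup; first by exists (normc (h (Some 0%N))); exists 0%N.
by move=> _ [n _ <-].
Qed.

Lemma Aalpha_norm_le f (B V : R) : (forall n, normc (f (Some n)) <= B) ->
  (var f <= V%:E)%E -> Aalpha_norm f <= B + V.
Proof.
move=> fB fV; apply: lerD; first exact: uniform_norm_le.
by rewrite -lee_fin fine_variation.
Qed.

Lemma Aalpha_norm_ge0 f : 0 <= Aalpha_norm f.
Proof.
apply: addr_ge0; last exact/fine_ge0/variation_ge0.
exact: le_trans (uniform_norm_ub f 0).
Qed.

Lemma variation_le_norm f : (var f <= (Aalpha_norm f)%:E)%E.
Proof.
rewrite -fine_variation lee_fin lerDr.
exact: le_trans (uniform_norm_ub f 0).
Qed.

Lemma Aalpha_normB f g :
  Aalpha_norm (f - g) <= Aalpha_norm f + Aalpha_norm g.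
Proof.
rewrite /Aalpha_norm addrACA; apply: Aalpha_norm_le => [n|].
  apply: (le_trans (le_normcD _ _)).
  by rewrite normcN lerD// uniform_norm_ub.
rewrite EFinD !fine_variation -nneseriesD; [|by move=> *; exact: jump_ge0..].
apply: lee_nneseries => [n _ _|n _]; first exact: jump_ge0.
rewrite -EFinD lee_fin -mulrDr ler_wpM2l//.
rewrite -[normc (g _ - _)]normcN; apply: le_trans (le_normcD _ _).
suff -> : (f - g) (Some n.+1) - (f - g) (Some n) =
  f (Some n.+1) - f (Some n) - (g (Some n.+1) - g (Some n)) :> R[i] by [].
by rewrite /= !opprD addrACA.
Qed.

Lemma Aalpha_norm0 : Aalpha_norm (0 : A) = 0.
Proof.
apply/eqP; rewrite eq_le Aalpha_norm_ge0 andbT -[X in _ <= X](addr0 0).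
apply: Aalpha_norm_le => [n|]; first by rewrite [normc _]normc0.
rewrite /Defs.variation eseries0// => n _ _.
by rewrite [X in normc X](subrr (0 : R[i])) [normc _]normc0 mulr0.
Qed.

Lemma Aalpha_norm1 : Aalpha_norm (1 : A) <= 1.
Proof.
rewrite -[leRHS]addr0; apply: Aalpha_norm_le => [n|]; first by rewrite [leLHS]normc1.
rewrite /Defs.variation eseries0// => n _ _.
by rewrite [X in normc X](subrr (1 : R[i])) [normc _]normc0 mulr0.
Qed.

Lemma Aalpha_distC f g : Aalpha_norm (f - g) = Aalpha_norm (g - f).
Proof.
suff le_dist (u v : A) : Aalpha_norm (u - v) <= Aalpha_norm (v - u).
  by apply/eqP; rewrite eq_le !le_dist.
have -> : u - v = 0 - (v - u) by rewrite sub0r opprB.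
apply: (le_trans (Aalpha_normB 0 (v - u))).
by rewrite Aalpha_norm0 add0r.
Qed.

Lemma jump_le_norm f n :
  (alpha n)%:num * normc (f (Some n.+1) - f (Some n)) <= Aalpha_norm f.
Proof.
rewrite -lee_fin; apply: le_trans (variation_le_norm f).
apply: le_trans (nneseries_lim_ge n.+1 _); last by move=> *; exact: jump_ge0.
by rewrite big_nat_recr//= leeDr// sume_ge0// => *; exact: jump_ge0.
Qed.

(** The jumps beyond [N] add up to at least the distance from the value at [N] to
the value at infinity.  This lower bound is what forbids bounded elements with
large values far out when the weights diverge. *)
Lemma tail_weight_le_norm f (K : R) N : 0 <= K ->
  (forall n, (N <= n)%N -> K <= (alpha n)%:num) ->
  K * normc (f (Some N) - f None) <= Aalpha_norm f.
Proof.
move=> K0 KN.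
have part m : K * normc (f (Some (N + m)%N) - f (Some N)) <= Aalpha_norm f.
  rewrite -lee_fin; apply: le_trans (variation_le_norm f).
  apply: le_trans (nneseries_lim_ge (N + m)%N _);
    last by move=> *; exact: jump_ge0.
  rewrite (big_cat_nat _ (n := N))//= ?leq_addr//.
  apply: le_trans (leeDr _ _); last by rewrite sume_ge0// => *; exact: jump_ge0.
  elim: m => [|m IH].
    by rewrite addn0 big_geq// [X in normc X](subrr (f (Some N) : R[i])) [normc _]normc0 mulr0.
  rewrite addnS big_nat_recr ?leq_addr//=; apply: le_trans (leeD2r _ IH).
  rewrite -EFinD lee_fin.
  have -> : f (Some (N + m).+1) - f (Some N) = (f (Some (N + m)%N) - f (Some N)) +
      (f (Some (N + m).+1) - f (Some (N + m)%N)) :> R[i].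
    by rewrite [RHS]addrC addrA subrK.
  apply: (le_trans (ler_wpM2l K0 (le_normcD _ _))).
  by rewrite mulrDr lerD2l ler_wpM2r// KN ?leq_addr.
apply/ler_addgt0Pr => e e0.
have e1 : 0 < e / (K + 1) by rewrite divr_gt0// ltr_wpDl.
have [M _ MP] := Aalpha_cvg f e1.
have /= := MP (N + M)%N (leq_addl _ _).
set z := f (Some (N + M)%N) => /ltW zf.
have -> : f (Some N) - f None = - (z - f (Some N)) + (z - f None) :> R[i].
  by rewrite opprB addrA subrK.
apply: (le_trans (ler_wpM2l K0 (le_normcD _ _))).
rewrite mulrDr lerD//; first by rewrite normcN part.
rewrite (le_trans (ler_wpM2l K0 zf))// mulrCA ler_piMr//; first exact: ltW.
by rewrite ler_pdivrMr ?ltr_wpDl// mul1r lerDl.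
Qed.

(** * Indicators of initial segments *)

Lemma variation_eventually_cst h N :
  (forall n, (N <= n)%N -> h (Some n.+1) = h (Some n)) ->
  var h = (\sum_(0 <= n < N) jump h n)%E.
Proof.
move=> hN; rewrite /Defs.variation (nneseries_split 0 N); last first.
  by move=> *; exact: jump_ge0.
rewrite add0n eseries0 ?adde0// => n Nn _.
by rewrite hN// [X in normc X](subrr (h (Some n) : R[i])) [normc _]normc0 mulr0.
Qed.

Definition initial_fun N : Ninfty -> R[i]^o :=
  fun x => if x is Some n then (n < N)%:R else 0.

Lemma initial_fun_subproof N : initial_fun N \in Aalpha_pred alpha.
Proof.
apply/asboolP; split.
  apply/Ninfty_continuousP; apply: cvg_near_cst.
  by exists N => // n /= Nn; rewrite ltnNge Nn.
rewrite (@variation_eventually_cst (initial_fun N) N) ?sumEFin ?ltry// => n Nn /=.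
by rewrite !ltnNge Nn leqW.
Qed.

Definition initial N : A := MkAalpha (initial_fun_subproof N).

Lemma initial_norm N : Aalpha_norm (initial N.+1) <= 1 + (alpha N)%:num.
Proof.
apply: Aalpha_norm_le => [n|].
  by rewrite /=; case: ltnP => _; rewrite ?normc1 ?[normc _]normc0.
rewrite (@variation_eventually_cst _ N.+1); last first.
  by move=> n Nn /=; rewrite [(n < _)%N]ltnNge [(n.+1 < _)%N]ltnNge Nn leqW.
rewrite big_nat_recr//= big_nat big1 ?add0e => [|n /andP[_ nN]]; last first.
  rewrite /jump /= !ltnS nN (ltnW nN).
  by rewrite [X in normc X](subrr (1 : R[i])) [normc _]normc0 mulr0.
by rewrite lee_fin /= ltnn ltnS leqnn sub0r normcN normc1 mulr1.
Qed.

Lemma initial_idem N : initial N * initial N = initial N.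
Proof.
apply/val_inj/funext => x; rewrite -[LHS]/(initial N x * initial N x).
by case: x => [n|] /=; [case: (n < N)%N; rewrite ?mulr1 ?mulr0 | exact: mulr0].
Qed.

(** Cutting off the first [N + 1] values of [f] creates one new jump, of size
[|f(N+1)|] and weight [alpha N], and keeps the later jumps. *)
Lemma initial_mul_approx f N (B e : R) :
  (forall n, (N < n)%N -> normc (f (Some n)) <= B) ->
  (\sum_(N.+1 <= n <oo) jump f n <= e%:E)%E ->
  Aalpha_norm (initial N.+1 * f - f) <= B + ((alpha N)%:num * B + e).
Proof.
move=> fB fe; set g := initial N.+1 * f - f.
have gE x : g x = initial N.+1 x * f x - f x :> R[i] by [].
have gle n : (n <= N)%N -> g (Some n) = 0 :> R[i].
  by rewrite gE /= ltnS => ->; rewrite mul1r subrr.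
have ggt n : (N < n)%N -> g (Some n) = - f (Some n) :> R[i].
  by move=> Nn; rewrite gE /= ltnNge Nn mul0r sub0r.
clearbody g.
have B0 : 0 <= B by apply: le_trans (fB N.+1 _).
apply: Aalpha_norm_le => [n|].
  have [nN|Nn] := leqP n N; first by rewrite gle// [normc _]normc0.
  by rewrite ggt// normcN fB.
rewrite /Defs.variation (nneseries_split 0 N.+1); last first.
  by move=> *; exact: jump_ge0.
rewrite add0n EFinD leeD//.
  rewrite big_nat_recr//= big_nat big1 ?add0e => [|n /andP[_ nN]]; last first.
    by rewrite !gle ?(ltnW nN)// [X in normc X](subrr (0 : R[i])) [normc _]normc0 mulr0.
  by rewrite lee_fin ler_wpM2l// (gle N)// [X in normc X]subr0 ggt// normcN fB.
apply: le_trans fe.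
rewrite -[leLHS]nneseries_addn; last by move=> *; exact: jump_ge0.
rewrite -[leRHS]nneseries_addn; last by move=> *; exact: jump_ge0.
apply: lee_nneseries => [n _ _|n _]; first exact: jump_ge0.
have -> : g (Some (n + N.+1).+1) - g (Some (n + N.+1)%N) =
    - (f (Some (n + N.+1).+1) - f (Some (n + N.+1)%N)) :> R[i].
  by rewrite !ggt ?leq_addl// ?leqW ?leq_addl// opprD.
by rewrite normcN.
Qed.

(** A bound on the selected weights makes the new jump negligible, as [f] tends
to 0; the other two contributions tend to 0 along all indices going to infinity. *)
Lemma initial_mul_cvg f (K : R) (s : nat -> nat) : f None = 0 ->
  (forall n, (n <= s n)%N) -> (forall n, (alpha (s n))%:num <= K) ->
  Aalpha_norm (initial (s n).+1 * f - f) @[n --> \oo] --> (0 : R).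
Proof.
move=> f0 ns sK; have K0 : 0 <= K by apply: le_trans (sK 0%N).
apply/cvgrPdist_lt => e e0.
have d0 : 0 < e / 2 / (K + 2) by rewrite !divr_gt0// ltr_wpDl.
set d := e / 2 / (K + 2) in d0.
have [N _ NP] := Aalpha_cvg f d0.
have := nneseries_tail_cvg (variation_lty f) (fun n _ => jump_ge0 f n).
move=> /fine_cvgP[MF /cvgrPdist_lt /(_ _ d0) MP].
have [M _ {}MP] := filterI MF MP.
exists (maxn N M) => // n /=; rewrite geq_max => /andP[Nn Mn].
rewrite sub0r normrN ger0_norm ?Aalpha_norm_ge0//.
apply: (@le_lt_trans _ _ (d + ((alpha (s n))%:num * d + d))).
  apply: initial_mul_approx => [m snm|].
    have /= := NP m; rewrite f0 subr0 => H; apply/ltW/H.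
    by rewrite (leq_trans Nn)// (leq_trans (ns n))// ltnW.
  have Msn : (M <= (s n).+1)%N by rewrite (leq_trans Mn)// (leq_trans (ns n)).
  have [/= MF' +] := MP _ Msn; rewrite /= sub0r normrN => /ltW /(le_trans (ler_norm _)).
  by rewrite -lee_fin fineK.
apply: (@le_lt_trans _ _ (e / 2)); last by rewrite gtr_pMr// invf_lt1// ltr1n.
have -> : e / 2 = d * (K + 2) by rewrite divfK// gt_eqF// ltr_wpDl.
rewrite addrCA -mulr2n mulrDr -[d *+ 2]mulr_natr lerD2r mulrC.
by rewrite ler_wpM2l// ltW.
Qed.

(** * Invertibility and ideals *)

(** Inversion is Lipschitz away from 0, so it preserves finite variation. *)
Lemma bounded_below_invertible f (m : R) : 0 < m ->
  (forall x, m <= normc (f x)) -> exists g, f * g = 1.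
Proof.
move=> m0 mf.
have f_neq0 x : f x != 0 :> R[i].
  by apply: contraTneq (lt_le_trans m0 (mf x)) => ->; rewrite [normc _]normc0 ltxx.
have invA : (fun x => (f x)^-1 : R[i]^o) \in Aalpha_pred alpha.
  apply/asboolP; split.
    by move=> x; exact: (@continuousV R[i] _ _ x (f_neq0 x) (@Aalpha_continuous f x)).
  apply: (@variation_lincomb _ _ (m ^- 2) 0 f f _ _ _ _ (variation_lty f) (variation_lty f)) => //.
    by rewrite invr_ge0 exprn_ge0// ltW.
  move=> n; rewrite mul0r addr0.
  have -> : (f (Some n.+1))^-1 - (f (Some n))^-1 =
      - (f (Some n.+1) - f (Some n)) * ((f (Some n.+1))^-1 * (f (Some n))^-1) :> R[i].
    by field; rewrite !f_neq0.
  rewrite normcM normcN mulrC ler_wpM2r// normcM !normcV expr2 invfM.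
  by rewrite ler_pM ?invr_ge0// lef_pV2 ?posrE ?(lt_le_trans m0).
exists (MkAalpha invA); apply/val_inj/funext => x.
exact: mulfV (f_neq0 x).
Qed.

Definition indicator n : A := initial n.+1 - initial n.

Lemma indicatorE n x : indicator n x = (x == Some n)%:R :> R[i].
Proof.
case: x => [m|]; last exact: subrr.
rewrite -[LHS]/((m < n.+1)%:R - (m < n)%:R : R[i]) ltnS leq_eqVlt (inj_eq Some_inj).
by have [->|_] /= := eqVneq m n; [rewrite ltnn; exact: subr0|exact: subrr].
Qed.

Lemma indicatorM n f : indicator n * f = f (Some n) *: indicator n.
Proof.
apply/val_inj/funext => x.
rewrite -[LHS]/(indicator n x * f x) -[RHS]/(f (Some n) * indicator n x).
by rewrite indicatorE; case: eqP => [->|_]; [rewrite mulrC | rewrite mul0r mulr0].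
Qed.

Definition point_ideal (x : Ninfty) : {pred A} := [pred f : A | f x == 0 :> R[i]].

(** This replaces the usual compactness argument with finitely many functions
and their conjugates: the idempotents [initial N] already reduce the question to
a single function. *)
Lemma proper_ideal_at_point (I : {pred A}) : idealr_closed I ->
  exists x, {subset I <= point_ideal x}.
Proof.
move=> [I0 I1 IB].
have IM u v : v \in I -> u * v \in I.
  by move=> vI; rewrite -[_ * _]addr0; exact: IB.
have ID u v : u \in I -> v \in I -> u + v \in I.
  by move=> uI vI; rewrite -[u]mul1r; exact: IB.
have [Iind|/existsNP[n /negP nI]] := pselect (forall n, indicator n \in I).
  exists None => f fI; apply: contraT; rewrite inE => f0.
  have initI N : initial N \in I.
    elim: N => [|N IH].
      suff -> : initial 0 = 0 by [].
      by apply/val_inj/funext => -[].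
    have -> : initial N.+1 = indicator N + initial N by rewrite subrK.
    by apply: ID => //; exact: Iind.
  (* Beyond some [N] the modulus of [f] is at least half its modulus at infinity. *)
  have c0 : 0 < normc (f None) / 2.
    rewrite divr_gt0// lt_neqAle normc_ge0 andbT eq_sym.
    by apply: contraNneq f0 => /eq0_normc ->.
  have [N _ NP] := Aalpha_cvg f c0.
  case/negP: I1.
  have [|x|g <-] := @bounded_below_invertible
    ((1 - initial N) * f + initial N) (Num.min (normc (f None) / 2) 1).
  + by rewrite lt_min c0 ltr01.
  + rewrite -[X in _ <= normc X]/((1 - initial N x) * f x + initial N x).
    have outside z : (1 - 0) * z + 0 = z :> R[i] by rewrite subr0 mul1r addr0.
    case: x => [n|] /=; last first.
      by rewrite outside ge_min ler_pdivrMr// ler_peMr ?normc_ge0 ?ler1n.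
    case: ltnP => nN; first by rewrite subrr mul0r add0r normc1 ge_min lexx orbT.
    rewrite outside ge_min; apply/orP; left.
    rewrite -(lerD2r (normc (f None) / 2)) -splitr.
    apply: le_trans (lerD (lexx _) (ltW (NP _ nN))).
    rewrite -[X in X <= _]normcN.
    rewrite -[X in normc X <= _](addKr (f (Some n))).
    by apply: le_trans (le_normcD _ _) _; rewrite normcN.
  + by rewrite mulrC; apply/IM; apply: ID => //; exact: IM.
exists (Some n) => f fI; apply: contraNT nI => fn0.
have -> : indicator n = ((f (Some n))^-1 *: indicator n) * f.
  by rewrite -scalerAl indicatorM scalerA mulVf// scale1r.
exact: IM.
Qed.

Lemma point_ideal_closed x : idealr_closed (point_ideal x).
Proof.
split=> [||u v w]; rewrite ?inE.
- exact: eqxx.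
- exact: oner_neq0.
rewrite -[(u * v + w) x]/(u x * v x + w x) => /eqP -> /eqP ->.
by rewrite mulr0 addr0.
Qed.

Lemma point_ideal_maximal x : maximal_ideal (point_ideal x).
Proof.
split=> [|I [_ I1 IB] xI f fI]; first exact: point_ideal_closed.
apply: contraNT I1; rewrite inE => fx0.
have : (f x)^-1%:A * f + (1 - (f x)^-1%:A * f) \in I.
  apply: IB => //; apply: xI; rewrite inE.
  rewrite -[X in X == _]/(1 - (f x)^-1 * 1 * f x).
  by rewrite mulr1 mulVf// subrr.
by rewrite subrKC.
Qed.

Lemma maximal_ideal_point (M : {pred A}) : maximal_ideal M ->
  exists x, M =i point_ideal x.
Proof.
move=> [Mid Mmax]; have [x Mx] := proper_ideal_at_point Mid.
exists x => f; apply/idP/idP; first exact: Mx.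
exact: Mmax (point_ideal_closed x) Mx f.
Qed.

(** * Characters *)

Local Notation char := {ptws A -> R[i]^o}.

Definition evaluation (x : Ninfty) : A -> R[i]^o := fun f => f x.

Lemma evaluation_zmod_morphism x : zmod_morphism (evaluation x). Proof. by []. Qed.
Lemma evaluation_monoid_morphism x : monoid_morphism (evaluation x). Proof. by []. Qed.
Lemma evaluation_scalable x : scalable (evaluation x). Proof. by []. Qed.

HB.instance Definition _ x :=
  GRing.isZmodMorphism.Build A R[i]^o (evaluation x) (evaluation_zmod_morphism x).
HB.instance Definition _ x :=
  GRing.isMonoidMorphism.Build A R[i]^o (evaluation x) (evaluation_monoid_morphism x).
HB.instance Definition _ x :=
  GRing.isScalable.Build R[i] A R[i]^o *:%R (evaluation x) (evaluation_scalable x).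

Lemma character_evaluation x : character_space (evaluation x : char).
Proof. by exists (evaluation x : {lrmorphism A -> R[i]^o}). Qed.

(** The kernel of a character is a proper ideal of codimension one, so its
inclusion in the ideal at [x] determines the character. *)
Lemma character_is_evaluation (phi : char) :
  character_space phi -> exists x, phi = evaluation x.
Proof.
move=> [chi _ <-]; pose I : {pred A} := [pred f | chi f == 0].
have [|x Ix] := @proper_ideal_at_point I.
  split=> [||u v w]; rewrite ?inE; first by rewrite rmorph0.
    by rewrite rmorph1 oner_neq0.
  have -> : chi (u * v + w) = chi u * chi v + chi w by rewrite rmorphD rmorphM.
  by move=> /eqP -> /eqP ->; rewrite mulr0 addr0.
exists x; apply/funext => f.
have : f - (chi f)%:A \in point_ideal x.
  have chiZ : chi (chi f)%:A = chi f.
    by rewrite -[RHS]mulr1 -[X in _ = _ * X](rmorph1 chi); exact: linearZ_LR.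
  apply: Ix; rewrite inE.
  have -> : chi (f - (chi f)%:A) = chi f - chi (chi f)%:A by exact: rmorphB.
  by rewrite chiZ subrr.
rewrite inE -[X in X == _]/(f x - chi f * 1) mulr1 subr_eq0 => /eqP fx.
exact: esym fx.
Qed.

(** A character not killing [p] kills [f], and not killing [p] is an open
condition.  This turns algebraic identities into statements about neighbourhoods
without computing the Gelfand topology. *)
Lemma ideal_near_annihilated (phi : char) f p :
  f * p = 0 -> phi p != 0 -> ideal_near phi f.
Proof.
move=> fp phip.
have nz : nbhs (phi p : R[i]^o) [set z | z != 0].
  exact: (@cvgr_neq0 R[i] R[i]^o _ (nbhs (phi p : R[i]^o)) _ id _ cvg_id phip).
have near_nz : nbhs (phi : char) [set psi : char | psi p != 0].
  exact: (@proj_continuous A (fun=> R[i]^o) p phi _ nz).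
suff : nbhs (phi : char) [set psi : char | character_space psi -> psi f = 0] by [].
apply: (filterS _ near_nz) => psi psip [chi _ chi_psi].
rewrite -chi_psi in psip *.
have : chi f * chi p = 0 by rewrite -rmorphM fp rmorph0.
by move/eqP; rewrite mulf_eq0 (negPf psip) orbF => /eqP.
Qed.

Lemma ideal_near_sub (phi : char) f :
  character_space phi -> ideal_near phi f -> phi f = 0.
Proof. by move=> cphi nf; exact: nbhs_singleton nf cphi. Qed.

Lemma evaluation_cvg : (evaluation (Some n) : char) @[n --> \oo] --> (evaluation None : char).
Proof.
apply/cvg_sup => f U [V [[W oW <-] Wf WU]].
have /Ninfty_continuousP cf := @Aalpha_continuous f.
have : nbhs (f None) W by exact: open_nbhs_nbhs.
by move/cf => cW; apply: (@filterS _ \oo _ _ _ _ cW) => n Wn; exact: WU.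
Qed.

(** A compact set is closed, and the evaluations at integers converge to the one
at infinity; so only finitely many of them lie in the set. *)
Lemma compact_away_from_infinity (E : set char) :
  compact E -> E `<=` @character_space R A `\ (evaluation None : char) ->
  exists N, forall psi, E psi -> psi (initial N) = 1.
Proof.
move=> cE sE.
have clE : closed E.
  apply: (compact_closed _ cE).
  by apply: (@hausdorff_product A (fun=> R[i]^o)) => ?; exact: norm_hausdorff.
have : nbhs (evaluation None : char) (~` E).
  by apply: open_nbhs_nbhs; split; [exact: closed_openC|case/sE => _ []].
move/evaluation_cvg => [N _ NP]; exists N => psi Epsi.
have [/character_is_evaluation[[n|] ?] psi0] := sE _ Epsi; subst; last by case: psi0.
rewrite /evaluation /=; have [//|Nn] := ltnP n N.
by case: (NP n Nn).
Qed.

End Aalpha_algebra.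

(** * Non-divergent weights and the approximate identity at infinity *)

Lemma limn_einf_ltyP (R : realType) (a : nat -> R) :
  (limn_einf (fun n => (a n)%:E) < +oo)%E <->
  exists K, forall N, exists n, (N <= n)%N /\ a n <= K.
Proof.
rewrite limn_einf_lim (cvg_lim _ (@cvg_einfs_sup _ _))//; split=> [|[K aK]]; last first.
  apply: le_lt_trans (ltry K); apply: ge_ereal_sup => _ [N _ <-].
  have [n [Nn anK]] := aK N; apply: (@le_trans _ _ (a n)%:E); last by rewrite lee_fin.
  by apply: ereal_inf_lbound; exists n.
apply: contraPP => /forallNP aK; apply/negP; rewrite -leNgt leye_eq.
apply/eqP/eqyP => K _; have /existsNP[N NK] := aK K.
apply: le_trans (ereal_sup_ubound _) => /=; last by exists N.
apply: le_ereal_inf_tmp => _ [n /= Nn <-]; rewrite lee_fin leNgt.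
by apply/negP => anK; apply: NK; exists n; split => //; exact: ltW.
Qed.

Section Aalpha_ditkin.
Set Implicit Arguments.
Unset Strict Implicit.
Variables (R : realType) (alpha : nat -> {posnum R}).
Local Notation A := (Aalpha alpha).
Local Notation char := {ptws A -> R[i]^o}.
Local Notation nrm := (@Aalpha_norm R alpha).
Local Notation liminf_finite :=
  (limn_einf (fun n => ((alpha n)%:num)%:E) < +oo)%E.

(** The common necessity argument: bounded elements that fall by at least [c]
beyond every [N].  If the weights were eventually above [d / c + 1], such an
element would have norm greater than [d]. *)
Lemma liminf_finite_of_drop (c d : R) : 0 < c ->
  (forall N, exists f : A,
    [/\ f None = 0, c <= normc (f (Some N)) & nrm f <= d]) ->
  liminf_finite.
Proof.
move=> c0 H; apply/limn_einf_ltyP; exists (d / c + 1) => N.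
apply: contrapT => /forallNP aK.
have [f [f0 fN fd]] := H N.
have d0 : 0 <= d by exact: le_trans (Aalpha_norm_ge0 f) fd.
have : (d / c + 1) * normc (f (Some N) - f None) <= d.
  apply: le_trans fd; apply: tail_weight_le_norm => [|n Nn].
    by rewrite addr_ge0// divr_ge0// ltW.
  by rewrite leNgt; apply/negP => /ltW an; apply: (aK n).
rewrite f0 [X in normc X]subr0 leNgt => /negP; apply.
apply: (@lt_le_trans _ _ ((d / c + 1) * c)).
  by rewrite mulrDl mul1r divfK ?gt_eqF// ltrDl.
by rewrite ler_pM2l// ltr_wpDl// divr_ge0// ltW.
Qed.

Lemma bounded_subsequence : liminf_finite ->
  exists (K : R) (s : nat -> nat),
    forall n, (n <= s n)%N /\ (alpha (s n))%:num <= K.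
Proof. by move=> /limn_einf_ltyP[K /choice[s sP]]; exists K, s. Qed.

(** An approximate identity must almost fix [initial N.+1], hence be at least 1/2
in modulus at [N]. *)
Lemma infinity_approximate_identityP :
  has_bounded_approximate_identity nrm [set f : A | f None = 0] <-> liminf_finite.
Proof.
split=> [[T [F [e [C [FF eM eC]]]]]|/bounded_subsequence[K [s sP]]].
  (* Any threshold in ]0, 1[ would do. *)
  have half : (0 : R) < 1 / 2 by rewrite divr_gt0.
  apply: (@liminf_finite_of_drop (1 / 2) C) => // N.
  have /cvgrPdist_lt/(_ _ half)/filter_ex[t] := eC (initial alpha N.+1) erefl.
  rewrite sub0r normrN ger0_norm ?Aalpha_norm_ge0// => et.
  exists (e t); have [et0 etC] := eM t; split=> //.
  set z := e t (Some N); have := le_lt_trans (normc_le_norm _ N) et.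
  have -> : (e t * initial alpha N.+1 - initial alpha N.+1) (Some N) = z - 1 :> R[i].
    rewrite -[LHS]/(z * (N < N.+1)%:R - (N < N.+1)%:R).
    by rewrite ltnSn mulr1.
  move=> z1; rewrite -(lerD2r (1 / 2)) -splitr.
  apply: le_trans (lerD (lexx _) (ltW z1)).
  rewrite -[normc (z - 1)]normcN -[X in X <= _](normc1 R).
  by rewrite -[X in normc X <= _](subrKC z 1) opprB le_normcD.
exists nat, \oo, (fun n => initial alpha (s n).+1), (1 + K); split.
- exact: eventually_filter.
- move=> n; split=> //; apply: le_trans (initial_norm _ _) _.
  by rewrite lerD2l; case: (sP n).
- by move=> f f0; apply: (@initial_mul_cvg _ _ _ K) => // n; case: (sP n).
Qed.

(** * Strong Ditkin algebras and relative units *)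

Lemma strong_ditkin_of_liminf : liminf_finite -> strong_ditkin nrm.
Proof.
move=> lf; split=> [phi cphi f|M].
  have [[n|] ->] := character_is_evaluation cphi => fphi e e0; last first.
    have [K [s sP]] := bounded_subsequence lf.
    have : nrm (initial alpha (s n).+1 * f - f) @[n --> \oo] --> (0 : R).
      by apply: (@initial_mul_cvg _ _ _ K) => // n; case: (sP n).
    move=> /cvgrPdist_lt /(_ _ e0) /filter_ex[n].
    rewrite sub0r normrN ger0_norm ?Aalpha_norm_ge0// => fe.
    exists (initial alpha (s n).+1 * f); last by rewrite Aalpha_distC.
    apply: (ideal_near_annihilated (p := 1 - initial alpha (s n).+1)).
      by rewrite mulrAC mulrBr mulr1 initial_idem subrr mul0r.
    by rewrite -[X in X != _]/(1 - 0 : R[i]) subr0 oner_neq0.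
  exists f.
    apply: (ideal_near_annihilated (p := indicator alpha n)).
      by rewrite mulrC indicatorM [f _]fphi scale0r.
    by rewrite -[X in X != _]/(indicator alpha n (Some n)) indicatorE eqxx oner_neq0.
  by rewrite subrr Aalpha_norm0.
move=> /maximal_ideal_point[[n|] Mx]; last first.
  have -> : [set f | f \in M] = [set f : A | f None = 0].
    by apply/seteqP; split=> f /=; rewrite Mx inE => /eqP.
  exact/infinity_approximate_identityP.
exists nat, \oo, (fun=> 1 - indicator alpha n), (nrm (1 - indicator alpha n)).
split.
- exact: eventually_filter.
- move=> _; split=> //=; rewrite Mx inE.
  by rewrite -[X in X == _]/(1 - indicator alpha n (Some n)) indicatorE eqxx subrr.
- move=> f /=; rewrite Mx inE => /eqP fn.
  have -> : (fun _ : nat => nrm ((1 - indicator alpha n) * f - f)) = cst 0.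
    apply/funext => k; rewrite mulrBl mul1r indicatorM fn scale0r subr0 subrr.
    exact: Aalpha_norm0.
  exact: cvg_cst.
Qed.

Lemma liminf_of_strong_ditkin : strong_ditkin nrm -> liminf_finite.
Proof.
move=> [_ bai]; apply/infinity_approximate_identityP.
have -> : [set f : A | f None = 0] = [set f | f \in @point_ideal R alpha None].
  by apply/seteqP; split=> f /=; rewrite inE => /eqP.
by apply: bai; exact: point_ideal_maximal.
Qed.

Lemma evaluation_neq x y (f : A) : f x <> f y -> (evaluation x : char) <> evaluation y.
Proof. by move=> fxy exy; apply: fxy; exact: (congr1 (@^~ f) exy). Qed.

(** Singletons are compact, and they are the only compact sets that the lower
bounds require. *)
Lemma relative_unit x y (C : R) :
  bounded_relative_units_at nrm (@evaluation R alpha x) C ->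
  (evaluation y : char) <> evaluation x ->
  exists f : A, [/\ f x = 0, f y = 1 & nrm f <= C].
Proof.
move=> bru yx; have [||f [fx fC fE]] := bru [set (evaluation y : char)].
- exact: compact_set1.
- by move=> _ ->; split=> //; exact: character_evaluation.
exists f; split=> //; last exact: (fE (evaluation y)).
exact: (ideal_near_sub (character_evaluation _ _) fx).
Qed.

Lemma relative_units_at_infinity (C : R) :
  (forall N, exists n, (N <= n)%N /\ (alpha n)%:num <= C) ->
  bounded_relative_units_at nrm (@evaluation R alpha None) (1 + C).
Proof.
move=> aC E cE sE; have [N EN] := compact_away_from_infinity cE sE.
have [n [Nn anC]] := aC N; exists (initial alpha n.+1); split.
- apply: (ideal_near_annihilated (p := 1 - initial alpha n.+1)).
    by rewrite mulrBr mulr1 initial_idem subrr.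
  by rewrite -[X in X != _]/(1 - 0 : R[i]) subr0 oner_neq0.
- by apply: le_trans (initial_norm _ _) _; rewrite lerD2l.
move=> psi Epsi; have [/character_is_evaluation[x psix] _] := sE _ Epsi.
have := EN _ Epsi; rewrite psix /evaluation; case: x {psix} => [m|] /=.
  case: (ltnP m N) => [mN _|_ /esym/eqP]; last by rewrite oner_eq0.
  by rewrite ltnS ltnW// (leq_trans mN).
by move/esym/eqP; rewrite oner_eq0.
Qed.

(** The predecessor is the index of the only jump when [n] is positive; for
[n = 0] the function is 0, which any weight bounds. *)
Lemma initial_norm_pred n : nrm (initial alpha n) <= 1 + (alpha n.-1)%:num.
Proof.
case: n => [|n]; last exact: initial_norm.
have -> : initial alpha 0 = 0 by apply/val_inj/funext => -[].
by rewrite Aalpha_norm0 addr_ge0.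
Qed.

(** One function serves for all compact sets because [n] is isolated; the bound
comes from estimating the three terms of [1 - initial n.+1 + initial n]
separately. *)
Lemma relative_units_at_integer n (C : R) :
  (alpha n)%:num <= C -> (alpha n.-1)%:num <= C ->
  bounded_relative_units_at nrm (@evaluation R alpha (Some n)) (3 + 2 * C).
Proof.
move=> anC an1C E _ sE; exists (1 - indicator alpha n); split.
- apply: (ideal_near_annihilated (p := indicator alpha n)).
    rewrite mulrC indicatorM -[X in X *: _]/(1 - indicator alpha n (Some n)).
    by rewrite indicatorE eqxx subrr scale0r.
  by rewrite -[X in X != _]/(indicator alpha n (Some n)) indicatorE eqxx oner_neq0.
- apply: le_trans (Aalpha_normB _ _) _.
  have -> : 3 + 2 * C = 1 + ((1 + C) + (1 + C)) by ring.
  apply: lerD; first exact: Aalpha_norm1.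
  apply: le_trans (Aalpha_normB _ _) _; apply: lerD.
    by apply: le_trans (initial_norm _ _) _; rewrite lerD2l.
  by apply: le_trans (initial_norm_pred _) _; rewrite lerD2l.
move=> psi Epsi; have [/character_is_evaluation[x ->] xn] := sE _ Epsi.
rewrite -[LHS]/(1 - indicator alpha n x) indicatorE.
by case: eqP xn => [->[]//|_ _]; exact: subr0.
Qed.

Lemma Bade_liminf : bounded_relative_units_Bade nrm <-> liminf_finite.
Proof.
split=> [bade|lf phi cphi].
  have [C _ bru] := bade _ (character_evaluation alpha None).
  apply: (@liminf_finite_of_drop 1 C) => // N.
  have [|f [f0 f1 fC]] := relative_unit (y := Some N) bru.
    apply: (@evaluation_neq _ _ (initial alpha N.+1)).
    by rewrite /= ltnSn; apply/eqP; exact: oner_neq0.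
  by exists f; rewrite f1 normc1.
have [[n|] ->] := character_is_evaluation cphi; last first.
  have /limn_einf_ltyP[K aK] := lf.
  have K0 : 0 <= K by have [n [_]] := aK 0%N; exact: le_trans.
  exists (1 + K); first by rewrite lerDl.
  exact: relative_units_at_infinity.
pose C := Num.max (alpha n)%:num (alpha n.-1)%:num.
exists (3 + 2 * C).
  by rewrite (@le_trans _ _ 3) ?ler1n// lerDl mulr_ge0// le_max; apply/orP; left.
by apply: relative_units_at_integer; rewrite le_max lexx ?orbT.
Qed.

Lemma Dales_bounded :
  bounded_relative_units_Dales nrm <-> [bounded (alpha n)%:num | n in [set: nat]].
Proof.
split=> [[C _ dales]|].
  exists C; split=> [|M CM n _ /=]; first exact: num_real.
  rewrite ger0_norm//; apply: le_trans (ltW CM).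
  have := dales _ (character_evaluation alpha (Some n)).
  move/(relative_unit (y := Some n.+1)) => [|f [f0 f1 fC]].
    apply: (@evaluation_neq _ _ (initial alpha n.+1)).
    by rewrite /= ltnSn ltnn; apply/eqP; rewrite eq_sym oner_neq0.
  by apply: le_trans fC; have := jump_le_norm f n; rewrite f0 f1 subr0 normc1 mulr1.
move=> [M [_ MP]]; pose C := M + 1.
have aC n : (alpha n)%:num <= C.
  by apply: le_trans (ler_norm _) _; apply: (MP C) => //; rewrite ltrDl.
have C0 : 0 <= C by apply: le_trans (aC 0%N).
exists (3 + 2 * C); first by rewrite (@le_trans _ _ 3) ?ler1n// lerDl mulr_ge0//.
move=> phi cphi; have [[n|] ->] := character_is_evaluation cphi.
  exact: relative_units_at_integer.
move=> E cE sE; have [|f [fJ fC fE]] := @relative_units_at_infinity C _ E cE sE.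
  by move=> N; exists N.
by exists f; split=> //; apply: le_trans fC _; rewrite lerD ?ler1n// ler_peMl ?ler1n.
Qed.

End Aalpha_ditkin.

Theorem theorem2p6 (R : realType) (alpha : nat -> {posnum R}) :
  [/\ strong_ditkin (@Aalpha_norm R alpha) <->
        (limn_einf (fun n => ((alpha n)%:num)%:E) < +oo)%E,
      has_bounded_approximate_identity (@Aalpha_norm R alpha)
          [set f : Aalpha alpha | f None = 0] <->
        (limn_einf (fun n => ((alpha n)%:num)%:E) < +oo)%E,
      bounded_relative_units_Bade (@Aalpha_norm R alpha) <->
        (limn_einf (fun n => ((alpha n)%:num)%:E) < +oo)%E &
      bounded_relative_units_Dales (@Aalpha_norm R alpha) <->
        [bounded (alpha n)%:num | n in [set: nat]]].
Proof.
split.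
- by split; [exact: liminf_of_strong_ditkin | exact: strong_ditkin_of_liminf].
- exact: infinity_approximate_identityP.
- exact: Bade_liminf.
- exact: Dales_bounded.
Qed.
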